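(* Let $T>t_0$ and let $\mathcal{X}_u\subset\mathbb{R}^n$ be a given (unsafe) set. Consider the differential inclusion with zero input $$\dot x(t)\in\mathcal{F}(t,x(t)),\quad t\ge t_0,\qquad x(t_0)=x_0,$$ where $\mathcal{F}(t,x)=\mathcal{F}(t,x,0)=co\{f_1(t,x,0),\dots,f_m(t,x,0)\}$. Suppose there exist a function $B:\mathbb{R}^n\times\mathbb{R}_{\ge0}\to\mathbb{R}$, $(x,t)\mapsto B(x,t)$, continuously differentiable in $x$ and in $t$, and a positive definite Lebesgue measurable function $W:\mathbb{R}^n\times\mathbb{R}_{\ge0}\to\mathbb{R}_{\ge0}$ such that $$B(x_T,T)-B(x_0,t_0)>0\quad\text{for all } x_T\in\mathcal{X}_u,$$ $$D_+B(x,t)(v,1)\le -W(x,t)\quad\text{for all } t\in[t_0,T],\ x\in\mathcal{X},\ v\in\mathcal{F}(t,x).$$ Then every solution $x(\cdot)$ of the differential inclusion satisfies $x(T)\notin\mathcal{X}_u$.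
   Context: $co$ denotes the convex hull. $\mathcal{X}\subseteq\mathbb{R}^n$, $\mathcal{T}\subseteq\mathbb{R}_{\ge0}$ and $\mathcal{U}$ (a subset of a Euclidean space) are the state, time and input sets, with $[t_0,T]\subseteq\mathcal{T}$, and $f_i:\mathcal{T}\times\mathcal{X}\times\mathcal{U}\to\mathbb{R}^n$, $i=1,\dots,m$, are (piecewise) smooth functions. The set-valued map is $\mathcal{F}(t,x,u)=co\{f_1(t,x,u),\dots,f_m(t,x,u)\}$. It has closed convex values, is upper hemicontinuous in $x$, and satisfies a one-sided Lipschitz condition: there is $C>0$ with $(x_1-x_2)^T(v_1-v_2)\le C\|x_1-x_2\|^2$ for all $t$, all $x_1,x_2\in\mathcal{X}$, and all $v_i\in\mathcal{F}(t,x_i,u)$. A solution on $[t_0,T]$ is an absolutely continuous $\mathcal{X}$-valued function satisfying the inclusion for almost every $t$ and the initial condition. The upper contingent derivative of a real function $V$ at a point $z$ in the direction $f$ is $$D_+V(z)(f)=\liminf_{h\to0^+,\ v\to f}\frac{V(z+hv)-V(z)}{h};$$ if $V$ is differentiable, then $D_+V(z)(f)=\nabla V(z)^Tf$. In $D_+B(x,t)(v,1)$ the direction is $v$ in the $x$-variable and $1$ in the $t$-variable. *)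

(* Defs.v *)
(* MathComp / MathComp-Analysis *)
From HB Require Import structures.
From mathcomp Require Import all_boot all_order all_algebra.
From mathcomp Require Import all_classical all_reals all_analysis.

Set Implicit Arguments.
Unset Strict Implicit.
Unset Printing Implicit Defensive.

Import Order.TTheory GRing.Theory Num.Theory.
Import numFieldNormedType.Exports.

Local Open Scope classical_set_scope.
Local Open Scope ring_scope.

Definition convex_hull (R : realType) (E : lmodType R) (A : set E) : set E :=
  smallest (@convex_set R E) A.

Definition inclusion_map (R : realType) (n p m : nat)
    (f : 'I_m -> R -> 'rV[R]_n -> 'rV[R]_p -> 'rV[R]_n)
    (t : R) (x : 'rV[R]_n) (u : 'rV[R]_p) : set 'rV[R]_n :=
  convex_hull [set f i t x u | i in [set: 'I_m]].

(* The library norm on 'rV[R]_n is the sup norm: the Euclidean inner product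
   and squared norm are written with dotv. *)
Definition dotv (R : realType) (n : nat) (x y : 'rV[R]_n) : R :=
  \sum_(i < n) x 0 i * y 0 i.

Fixpoint Ck_on (R : realType) (E F : normedModType R) (k : nat) (O : set E)
    (g : E -> F) : Prop :=
  match k with
  | 0 => forall z, O z -> {for z, continuous g}
  | k'.+1 => (forall z, O z -> differentiable g z) /\
             (forall v, Ck_on k' O (fun z => 'D_v g z))
  end.

Definition smooth_on (R : realType) (E F : normedModType R) (O : set E)
    (g : E -> F) : Prop :=
  forall k, Ck_on k O g.

(* The pieces are the relatively open sets P j `&` D; on each of them f is the
   restriction of a map smooth on a neighbourhood of the piece's relative
   closure in D. Nothing is asked of f on the boundaries of the pieces (jumps
   are allowed). A smooth function on D is the case of a single piece. *)
Definition piecewise_smooth_on (R : realType) (E F : normedModType R)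
    (D : set E) (f : E -> F) : Prop :=
  exists P : nat -> set E,
    [/\ forall j, open (P j),
        forall z, D z ->
          exists2 N, nbhs z N & finite_set [set j | P j `&` N !=set0],
        D `<=` \bigcup_j closure (P j `&` D)
      & forall j, exists (O : set E) (g : E -> F),
          [/\ open O, closure (P j `&` D) `&` D `<=` O, smooth_on O g &
              forall z, P j z -> D z -> f z = g z]].

Definition upper_hemicontinuous_on (R : realType) (E F : normedModType R)
    (X : set E) (G : E -> set F) : Prop :=
  forall x, X x -> forall O : set F, open O -> G x `<=` O ->
    \forall y \near x, X y -> G y `<=` O.

Definition one_sided_Lipschitz (R : realType) (n p : nat) (TT : set R)
    (X : set 'rV[R]_n) (U : set 'rV[R]_p)
    (F : R -> 'rV[R]_n -> 'rV[R]_p -> set 'rV[R]_n) : Prop :=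
  exists2 C : R, 0 < C &
    forall t u x1 x2 v1 v2, TT t -> U u -> X x1 -> X x2 ->
      F t x1 u v1 -> F t x2 u v2 ->
      dotv (x1 - x2) (v1 - v2) <= C * dotv (x1 - x2) (x1 - x2).

Definition absolutely_continuous_on (R : realType) (E : normedModType R)
    (a b : R) (x : R -> E) : Prop :=
  forall e : R, 0 < e -> exists2 d : R, 0 < d &
    forall (k : nat) (l r : 'I_k -> R),
      (forall i, a <= l i /\ l i <= r i /\ r i <= b) ->
      trivIset [set: 'I_k] (fun i => `]l i, r i[%classic) ->
      \sum_(i < k) (r i - l i) < d ->
      \sum_(i < k) `|x (r i) - x (l i)| < e.

(* G is the right-hand side (t, x) |-> G t x. *)
Definition is_solution (R : realType) (n : nat) (X : set 'rV[R]_n)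
    (G : R -> 'rV[R]_n -> set 'rV[R]_n) (t0 T : R) (x0 : 'rV[R]_n)
    (x : R -> 'rV[R]_n) : Prop :=
  [/\ absolutely_continuous_on t0 T x,
      forall t, t0 <= t <= T -> X (x t),
      x t0 = x0
    & {ae (@lebesgue_measure R), forall t, t0 <= t <= T ->
         derivable x t 1 /\ G t (x t) (derive1 x t)}].

Definition contingent_derivative (R : realType) (E : normedModType R)
    (V : E -> R) (z f : E) : \bar R :=
  limf_einf (fun q : R * E => ((V (z + q.1 *: q.2) - V z) / q.1)%:E)
    (filter_prod (0 : R)^'+ (nbhs f)).

(* Functions on R^n x R_{>=0} are represented by total functions on
   'rV[R]_n * R; every condition on them only involves their values on
   halfspace R n. *)
Definition halfspace (R : realType) (n : nat) : set ('rV[R]_n * R) :=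
  [set z | 0 <= z.2].
Arguments halfspace : clear implicits.

(* The derivative in t is one-sided at t = 0. *)
Definition continuously_differentiable_xt (R : realType) (n : nat)
    (B : 'rV[R]_n * R -> R) : Prop :=
  [/\ forall z, halfspace R n z ->
        differentiable (fun y : 'rV[R]_n => B (y, z.2)) z.1,
      forall v : 'rV[R]_n, {within halfspace R n, continuous
        (fun z : 'rV[R]_n * R => 'D_v (fun y : 'rV[R]_n => B (y, z.2)) z.1)}
    & exists2 dB : 'rV[R]_n * R -> R,
        forall z, halfspace R n z ->
          (fun h : R => h^-1 * (B (z.1, z.2 + h) - B z))
            @ within [set h | 0 <= z.2 + h] 0^' --> dB z
        & {within halfspace R n, continuous dB}].

Definition box (R : realType) (n : nat) (a b : 'rV[R]_n * R) :
    set ('rV[R]_n * R) :=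
  [set z : 'rV[R]_n * R | (forall i, a.1 0 i <= z.1 0 i <= b.1 0 i) /\ a.2 <= z.2 <= b.2].

Definition box_volume (R : realType) (n : nat) (a b : 'rV[R]_n * R) : R :=
  (\prod_(i < n) Num.max 0 (b.1 0 i - a.1 0 i)) * Num.max 0 (b.2 - a.2).

Definition lebesgue_outer (R : realType) (n : nat) (A : set ('rV[R]_n * R)) :
    \bar R :=
  ereal_inf [set s | exists a b : nat -> 'rV[R]_n * R,
    A `<=` \bigcup_k box (a k) (b k) /\
    s = (\sum_(0 <= k <oo) (box_volume (a k) (b k))%:E)%E].

(* Lebesgue measurability on halfspace R n, a Lebesgue measurable subset of
   R^{n+1}. *)
Definition lebesgue_measurable_fun (R : realType) (n : nat)
    (W : 'rV[R]_n * R -> R) : Prop :=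
  forall Y : set R, measurable Y ->
    caratheodory_measurable (@lebesgue_outer R n) (halfspace R n `&` W @^-1` Y).

Definition positive_definite (R : realType) (n : nat)
    (W : 'rV[R]_n * R -> R) : Prop :=
  forall t, 0 <= t -> W (0, t) = 0 /\ forall x, x != 0 -> 0 < W (x, t).

(* Main.v *)
Require Import Defs.
From HB Require Import structures.
From mathcomp Require Import all_boot all_order all_algebra.
From mathcomp Require Import all_classical all_reals all_analysis.
From mathcomp Require Import ring lra.

Set Implicit Arguments.
Unset Strict Implicit.
Unset Printing Implicit Defensive.

Import Order.TTheory GRing.Theory Num.Theory.
Import numFieldNormedType.Exports.

Local Open Scope classical_set_scope.
Local Open Scope ring_scope.

(** Along a solution x, the function g t = B (x t, t) should be nonincreasing on
    [t0, T], because its derivative at almost every t is the derivative of B at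
    (x t, t) in the direction (x' t, 1), which the contingent hypothesis bounds
    by - W <= 0. Then B (x T, T) <= B (x0, t0), which no point of the unsafe
    set satisfies.

    Three points need care.

    - The contingent derivative is a lower limit over all directions close to
      (v, 1), so it could a priori lie below the derivative along the
      curve. It does not, because continuous partial derivatives make B strictly
      differentiable, even at t = 0 when only times t >= 0 are used
      ([C1_strictly_differentiable], [contingent_derivative_ge]).

    - An almost everywhere inequality on the derivative says nothing by itself;
      the exceptional null set is harmless because x is absolutely continuous
      and B is Lipschitz near each point of the curve. The null set is covered
      by an open set of small measure; a partition of the interval is chosen so
      that each piece either is tagged at a good point, where g grows at most by
      e times the length, or lies in that open set, and the pieces of the second
      kind together contribute little by absolute continuity
      ([nonincreasing_of_ae_straddle]).

    - The Lipschitz bounds are only local, but g v <= g u is an additive property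
      of the interval [u, v], so proving it for short intervals is enough.

    Partitions and local-to-global steps all go through one induction principle
    on intervals, [interval_induction]. It also yields a mean value inequality
    that needs only one-sided derivatives at end points. *)

(** * Additive interval predicates *)

(** Cousin's lemma as an induction principle: each t has its own gauge d, and P
    propagates from gauge-fine intervals to [a, b]. The supremum of the c with
    P a c is reached and, by its own gauge, cannot be smaller than b. *)
Lemma interval_induction (R : realType) (P : R -> R -> Prop) (a b : R) :
  a <= b ->
  (forall t, a <= t <= b -> exists2 d : R, 0 < d &
     forall u v, a <= u -> u <= t -> t <= v -> v <= b -> v - u < d -> P u v) ->
  (forall u c v, a <= u -> u <= c -> c <= v -> v <= b ->
     P u c -> P c v -> P u v) ->
  P a b.
Proof.
move=> ab loc add.
pose S := [set c | a <= c <= b /\ P a c].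
have Sa : S a.
  split; first by rewrite lexx ab.
  have [|d d0 +] := loc a; first by rewrite lexx ab.
  by apply; rewrite ?subrr.
have Sb : ubound S b by move=> c [/andP[]].
have supS : has_sup S by split; [exists a | exists b].
pose c := sup S.
have ac : a <= c by apply: ub_le_sup => //; exists b.
have cb : c <= b by apply: ge_sup => //; exists a.
have [|d d0 Pd] := loc c; first by rewrite ac cb.
have [s [/andP[as_ sb] Ps] cs] := sup_adherent (divr_gt0 d0 (ltr0Sn _ 1)) supS.
have sc : s <= c by apply: ub_le_sup; [exists b | split => //; rewrite as_ sb].
(* Past the supremum, a gauge interval at c still extends S. *)
pose v := Num.min b (c + d / 3%:R).
have cv : c <= v by rewrite le_min cb lerDl divr_ge0 // ltW.
have vb : v <= b by rewrite ge_min lexx.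
have vd : v <= c + d / 3%:R by rewrite ge_min lexx orbT.
have Pav : P a v.
  apply: (add a s v) => //; first exact: le_trans cv.
  apply: Pd => //; rewrite -/c in cs; lra.
have vc : v <= c.
  by apply: ub_le_sup; [exists b | split => //; rewrite (le_trans ac cv) vb].
suff -> : b = v by [].
rewrite /v; case: leP => // h.
have : v = c + d / 3%:R by rewrite /v; case: leP h => //; lra.
lra.
Qed.

(** On an interval [u, v] around its tag t, the two increments from t add up to
    at most (M + e) * (v - u), and such bounds are additive. Only increments
    inside [a, b] are compared, so one-sided information at a and b suffices; this
    is what the derivative in time at t = 0 provides. *)
Lemma mean_value_straddle (R : realType) (phi : R -> R) (a b M : R) :
  a <= b ->
  (forall t, a <= t <= b -> forall e : R, 0 < e -> exists2 d : R, 0 < d &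
     forall s, a <= s <= b -> `|s - t| < d ->
       `|phi s - phi t| <= (M + e) * `|s - t|) ->
  `|phi b - phi a| <= M * (b - a).
Proof.
move=> ab H; apply/ler_addgt0Pl => e e0.
set ba := b - a; have ba0 : 0 <= ba by rewrite subr_ge0.
pose e' := e / (ba + 1).
have e'0 : 0 < e' by rewrite divr_gt0 // ltr_wpDl.
apply: (@le_trans _ _ ((M + e') * (b - a))); last first.
  rewrite mulrDl addrC lerD2r /e' -/ba mulrAC ler_pdivrMr ?ltr_wpDl //.
  by rewrite ler_wpM2l ?lerDl // ltW.
apply: (interval_induction
  (P := fun u v => `|phi v - phi u| <= (M + e') * (v - u))) => //.
- move=> t tab; have [d d0 Hd] := H t tab _ e'0; exists d => // u v au ut tv vb uvd.
  have -> : phi v - phi u = (phi v - phi t) - (phi u - phi t) by lra.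
  apply: (le_trans (ler_normB _ _)).
  have /Hd h1 : a <= v <= b by rewrite vb (le_trans au) // (le_trans ut).
  have /Hd h2 : a <= u <= b by rewrite au (le_trans ut) // (le_trans tv).
  have e1 : `|v - t| = v - t by rewrite ger0_norm ?subr_ge0.
  have e2 : `|u - t| = t - u by rewrite distrC ger0_norm ?subr_ge0.
  rewrite e1 in h1; rewrite e2 in h2.
  have -> : (M + e') * (v - u) = (M + e') * (v - t) + (M + e') * (t - u) by lra.
  apply: lerD; [apply: h1 | apply: h2]; lra.
- move=> u c v _ _ _ _ h1 h2.
  have -> : phi v - phi u = (phi c - phi u) + (phi v - phi c) by lra.
  apply: (le_trans (ler_normD _ _)); lra.
Qed.

(** Applied with c a derivative at a nearby base point, this measures how far phi
    is from being affine with slope c. *)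
Lemma mean_value_linear (R : realType) (phi dphi : R -> R) (a b c M : R) :
  a <= b ->
  (forall t, a <= t <= b ->
     (fun h : R => h^-1 * (phi (t + h) - phi t))
       @ within [set h | a <= t + h <= b] 0^' --> dphi t) ->
  (forall t, a <= t <= b -> `|dphi t - c| <= M) ->
  `|phi b - phi a - c * (b - a)| <= M * (b - a).
Proof.
move=> ab dphiE dphic.
have -> : phi b - phi a - c * (b - a) = (phi b - c * b) - (phi a - c * a) by lra.
apply: (mean_value_straddle (phi := fun t => phi t - c * t)) => // t tab e e0.
have := dphiE t tab => /cvgrPdist_lt /(_ _ e0).
rewrite near_withinE => /nbhs_ballP[d /= d0 Hd]; exists d => // s sab std.
have [->|st] := eqVneq s t; first by rewrite !subrr normr0 mulr0.
have st0 : s - t != 0 by rewrite subr_eq0.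
have := Hd (s - t); rewrite /ball /= sub0r normrN => /(_ std st0).
rewrite addrC subrK => /(_ sab) h.
have -> : phi s - c * s - (phi t - c * t) =
    ((s - t)^-1 * (phi s - phi t) - dphi t + (dphi t - c)) * (s - t).
  by field.
rewrite normrM ler_wpM2r // addrC (le_trans (ler_normD _ _)) // lerD ?dphic //.
by rewrite distrC ltW.
Qed.

(** * Absolute continuity and almost everywhere decrease *)

Lemma open_cover_null (R : realType) (N : set R) (e : R) :
  (@lebesgue_measure R).-negligible N -> 0 < e ->
  exists O : set R, [/\ open O, N `<=` O & (lebesgue_measure O < e%:E)%E].
Proof.
move=> [A [mA A0 NA]] e0.
have [|O [oO AO]] := lebesgue_regularity_outer mA _ e0.
  by rewrite [X in (X < _)%E](_ : _ = 0%E) ?ltry //; exact: A0.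
move=> Oe; exists O; split=> //; first exact: subset_trans AO.
have mOA : measurable (O `\` A)
  by apply: measurableD => //; exact: measurable_realfun.open_measurable.
have := measureU2 lebesgue_measure mA mOA.
rewrite setDUK // => h; apply: le_lt_trans Oe; apply: le_trans h _.
rewrite [X in (X + _ <= _)%E](_ : _ = 0%E) ?add0e //; exact: A0.
Qed.

Lemma sum_length_le_measure (R : realType) (k : nat) (l r : 'I_k -> R)
    (O : set R) (e : R) :
  open O -> (lebesgue_measure O < e%:E)%E ->
  (forall i, l i <= r i) ->
  (forall i, `]l i, r i[%classic `<=` O) ->
  trivIset [set: 'I_k] (fun i => `]l i, r i[%classic) ->
  \sum_(i < k) (r i - l i) < e.
Proof.
move=> oO Oe lr lrO tlr; rewrite -lte_fin; apply: le_lt_trans Oe.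
have -> : (\sum_(i < k) (r i - l i))%:E =
    \sum_(i < k) (lebesgue_measure `]l i, r i[%classic : \bar R).
  rewrite -sumEFin; apply: eq_bigr => i _.
  rewrite lebesgue_measure_itv /= lte_fin.
  case: ltP => // h; have -> : r i = l i by apply/eqP; rewrite eq_le h lr.
  by rewrite subrr.
rewrite -(measure_bigsetU_ord _ xpredT) //; apply: le_measure.
- by rewrite inE; apply: bigsetU_measurable.
- by rewrite inE; exact: measurable_realfun.open_measurable.
- apply: (big_ind (fun A => A `<=` O)) => //.
  move=> A A' AO AO' t [].
  + exact: AO.
  + exact: AO'.
Qed.

Lemma absolutely_continuous_onW (R : realType) (E : normedModType R)
    (a b u v : R) (x : R -> E) :
  a <= u -> v <= b ->
  absolutely_continuous_on a b x -> absolutely_continuous_on u v x.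
Proof.
move=> au vb ac e /ac[d d0 Hd]; exists d => // k l r lr; apply: Hd => i.
by have [h1 [h2 h3]] := lr i; rewrite (le_trans au) // (le_trans h3).
Qed.

Lemma absolutely_continuous_increment (R : realType) (E : normedModType R)
    (a b : R) (x : R -> E) (e : R) :
  absolutely_continuous_on a b x -> 0 < e ->
  exists2 d : R, 0 < d & forall u v, a <= u -> u <= v -> v <= b -> v - u < d ->
    `|x v - x u| < e.
Proof.
move=> ac /ac[d d0 Hd]; exists d => // u v au uv vb uvd.
have := Hd 1%N (fun=> u) (fun=> v); rewrite !big_ord1; apply=> //.
by move=> i j _ _ _; rewrite !ord1.
Qed.

(** The estimate g b - g a <= e * (b - a) + L * (e + e) for every e. The interval
    property Q collects, along an interval, the disjoint pieces tagged at bad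
    points: they lie in an open set of measure less than min d e, so their total
    length is less than e and, by absolute continuity, so is the sum of the
    increments of x over them. *)
Lemma nonincreasing_of_ae_straddle (R : realType) (E : normedModType R)
    (x : R -> E) (g : R -> R) (a b L : R) (N : set R) :
  a <= b ->
  absolutely_continuous_on a b x ->
  0 <= L ->
  (forall l r, a <= l -> l <= r -> r <= b ->
     `|g r - g l| <= L * (`|x r - x l| + (r - l))) ->
  (@lebesgue_measure R).-negligible N ->
  (forall t, a <= t <= b -> ~ N t -> forall e : R, 0 < e ->
     exists2 d : R, 0 < d & forall u v, a <= u -> u <= t -> t <= v -> v <= b ->
       v - u < d -> g v - g u <= e * (v - u)) ->
  g b <= g a.
Proof.
move=> ab ac L0 gL N0 gN; rewrite -subr_le0; apply/ler_addgt0Pl => e0 e00.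
rewrite addr0.
(* With this e the final bound e * (b - a) + L * (e + e) stays below e0. *)
pose e := e0 / (b - a + 2 * L + 1).
have den0 : 0 < b - a + 2 * L + 1 by lra.
have e_gt0 : 0 < e by rewrite divr_gt0.
have [d d0 Hd] := ac _ e_gt0.
have min0 : 0 < Num.min d e by rewrite lt_min d0.
have [G [oO NO Ode]] := open_cover_null N0 min0.
pose Q u v := exists s : seq (R * R),
  [/\ all (fun p => [&& u <= p.1, p.1 <= p.2 & p.2 <= v]) s,
      pairwise (fun p q : R * R => p.2 <= q.1) s,
      forall p, p \in s -> `]p.1, p.2[%classic `<=` G &
      g v - g u <= e * (v - u) + \sum_(p <- s) `|g p.2 - g p.1| ].
have : Q a b.
  apply: interval_induction => //.
  - move=> t tab; have [Nt|Nt] := pselect (N t).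
    + have /nbhs_ballP[r /= r0 rO] := open_nbhs_nbhs (conj oO (NO _ Nt)).
      exists r => // u v au ut tv vb uvr; exists [:: (u, v)]; split => //=.
      * by rewrite !lexx (le_trans ut).
      * move=> p; rewrite inE => /eqP -> /= y /=; rewrite in_itv /= => /andP[h1 h2].
        apply: rO; rewrite /ball /= ltr_norml; lra.
      * rewrite big_seq1 /= (le_trans (ler_norm _)) // lerDr.
        rewrite mulr_ge0 //; first exact: ltW.
        by rewrite subr_ge0 (le_trans ut).
    + have [r r0 Hr] := gN t tab Nt _ e_gt0; exists r => // u v au ut tv vb uvr.
      by exists [::]; split => //; rewrite big_nil addr0; exact: Hr.
  - move=> u c v _ uc cv _ [s1 [s1i s1p s1O s1g]] [s2 [s2i s2p s2O s2g]].
    exists (s1 ++ s2); split.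
    + rewrite all_cat; apply/andP; split.
        by apply: sub_all s1i => p /and3P[-> -> h] /=; exact: le_trans cv.
      by apply: sub_all s2i => p /and3P[h -> ->]; rewrite (le_trans uc).
    + rewrite pairwise_cat s1p s2p !andbT; apply/allrelP => p q ps qs.
      have /and3P[_ _ h1] := allP s1i _ ps; have /and3P[h2 _ _] := allP s2i _ qs.
      exact: le_trans h2.
    + by move=> p; rewrite mem_cat => /orP[/s1O|/s2O].
    + rewrite big_cat /=; lra.
move=> [s [si sp sO sg]].
pose k := size s; pose l (i : 'I_k) := (nth (0, 0) s i).1.
pose r (i : 'I_k) := (nth (0, 0) s i).2.
have lr i : a <= l i /\ l i <= r i /\ r i <= b.
  by have /and3P[] := allP si _ (mem_nth (0, 0) (ltn_ord i)).
have tlr : trivIset [set: 'I_k] (fun i => `]l i, r i[%classic).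
  have dis (i j : 'I_k) : (i < j)%N -> `]l i, r i[%classic `&` `]l j, r j[%classic = set0.
    move=> ij; rewrite -subset0 => t [] /=; rewrite !in_itv /= => /andP[_ h1] /andP[h2 _].
    have h3 : r i <= l j.
      by have /(pairwiseP (0, 0)) := sp; apply => //; rewrite inE ltn_ord.
    by have := lt_trans (lt_le_trans h1 h3) h2; rewrite ltxx.
  move=> i j _ _ /set0P; case: (ltngtP i j) => [/dis ->|/dis|/val_inj //].
    by rewrite eqxx.
  by rewrite setIC => ->; rewrite eqxx.
have len : \sum_(i < k) (r i - l i) < Num.min d e.
  apply: (sum_length_le_measure oO Ode) => // i; first by have [_ []] := lr i.
  exact/sO/mem_nth.
have lend : \sum_(i < k) (r i - l i) < d by rewrite (lt_le_trans len) // ge_min lexx.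
have lene : \sum_(i < k) (r i - l i) < e by rewrite (lt_le_trans len) // ge_min lexx orbT.
have xe := Hd _ _ _ lr tlr lend.
have gs : \sum_(p <- s) `|g p.2 - g p.1| <= L * (2 * e).
  rewrite (big_nth (0, 0)) big_mkord.
  apply: (@le_trans _ _ (\sum_(i < k) L * (`|x (r i) - x (l i)| + (r i - l i)))).
    by apply: ler_sum => i _; have [? []] := lr i => *; exact: gL.
  rewrite -mulr_sumr big_split /= ler_wpM2l //; lra.
apply: (le_trans sg).
have -> : e0 = e * (b - a + 2 * L + 1) by rewrite /e divfK // gt_eqF.
lra.
Qed.

(** * Strict differentiability on the half-space *)

Lemma mx_entry_norm (R : realType) (n : nat) (w : 'rV[R]_n) (i : 'I_n) :
  `|w 0 i| <= `|w|.
Proof.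
rewrite [`|w|]mx_normrE; apply: (le_trans _ (le_bigmax _ _ (0, i))) => //.
Qed.

Lemma dotv_norm (R : realType) (n : nat) (c w : 'rV[R]_n) :
  `|dotv c w| <= (\sum_(i < n) `|c 0 i|) * `|w|.
Proof.
rewrite /dotv (le_trans (ler_norm_sum _ _ _)) // mulr_suml ler_sum // => i _.
by rewrite normrM ler_wpM2l // mx_entry_norm.
Qed.

Lemma dotvD (R : realType) (n : nat) (c w w' : 'rV[R]_n) :
  dotv c (w + w') = dotv c w + dotv c w'.
Proof.
by rewrite /dotv -big_split; apply: eq_bigr => i _; rewrite mxE mulrDr.
Qed.

Lemma dotvZ (R : realType) (n : nat) (c w : 'rV[R]_n) (a : R) :
  dotv c (a *: w) = a * dotv c w.
Proof.
by rewrite /dotv mulr_sumr; apply: eq_bigr => i _; rewrite mxE mulrCA.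
Qed.

Lemma dotvBl (R : realType) (n : nat) (c c' w : 'rV[R]_n) :
  dotv (c - c') w = dotv c w - dotv c' w.
Proof.
by rewrite /dotv -sumrB; apply: eq_bigr => i _; rewrite !mxE mulrBl.
Qed.

Lemma derive_dotv (R : realType) (n : nat) (f : 'rV[R]_n -> R) (y w : 'rV[R]_n) :
  differentiable f y -> 'D_w f y = dotv (\row_i 'D_(delta_mx 0 i) f y) w.
Proof.
move=> df; rewrite deriveE // [in LHS](row_sum_delta w) linear_sum /=.
by apply: eq_bigr => i _; rewrite linearZ /= mxE deriveE // mulrC.
Qed.

(** The derivative at z with the base point moving: increments between any two
    points near z are controlled, not only increments starting at z. This one
    property yields local Lipschitz bounds, the chain rule along curves and a
    lower bound on contingent derivatives. *)
Definition strictly_differentiable (R : realType) (n : nat)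
    (B : 'rV[R]_n * R -> R) (z : 'rV[R]_n * R) (c : 'rV[R]_n) (d : R) :=
  forall e : R, 0 < e -> exists2 r : R, 0 < r & forall y y' s s',
    0 <= s -> 0 <= s' -> `|y - z.1| < r -> `|y' - z.1| < r ->
    `|s - z.2| < r -> `|s' - z.2| < r ->
    `|B (y', s') - B (y, s) - (dotv c (y' - y) + d * (s' - s))| <=
      e * (`|y' - y| + `|s' - s|).

Lemma within_halfspace_near (R : realType) (n : nat) (F : 'rV[R]_n * R -> R)
    (z : 'rV[R]_n * R) (e : R) :
  {within halfspace R n, continuous F} -> halfspace R n z -> 0 < e ->
  exists2 r : R, 0 < r & forall y s, 0 <= s -> `|y - z.1| < r ->
    `|s - z.2| < r -> `|F (y, s) - F z| < e.
Proof.
move=> /subspace_continuousP cF zH e0.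
have /cvgrPdist_lt /(_ _ e0) := cF z zH.
rewrite near_withinE => /nbhs_ballP[r /= r0 Hr]; exists r => // y s s0 yr sr.
rewrite distrC; apply: Hr => //; split; rewrite /= -ball_normE /ball_ /=.
  by rewrite distrC.
by rewrite distrC.
Qed.

(** Each partial increment is handled by the mean value inequality after
    subtracting the linear part at z; what remains is the oscillation of the
    partial derivatives near z, small by continuity. Segments between points of
    the half-space stay inside it, so the boundary t = 0 is no exception. *)
Lemma C1_strictly_differentiable (R : realType) (n : nat)
    (B : 'rV[R]_n * R -> R) (z : 'rV[R]_n * R) :
  continuously_differentiable_xt B -> halfspace R n z ->
  exists (c : 'rV[R]_n) (d : R), strictly_differentiable B z c d.
Proof.
move=> [dx cDx [dB dBE cdB]] zH.
pose D i (y : 'rV[R]_n * R) := 'D_(delta_mx 0 i) (fun y' : 'rV[R]_n => B (y', y.2)) y.1.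
exists (\row_i D i z), (dB z) => e e0.
(* The n partial derivatives in the state share the error e. *)
pose e' := e / (n%:R + 1).
have n1 : 0 < n%:R + 1 :> R by rewrite ltr_wpDl.
have e'0 : 0 < e' by rewrite divr_gt0.
have [r1 r10 Hr1] := within_halfspace_near cdB zH e0.
have [r2 r20 Hr2] : exists2 r : R, 0 < r & forall i y s, 0 <= s ->
    `|y - z.1| < r -> `|s - z.2| < r -> `|D i (y, s) - D i z| < e'.
  have /choice[r Hr] : forall i, exists r : R, 0 < r /\ forall y s, 0 <= s ->
      `|y - z.1| < r -> `|s - z.2| < r -> `|D i (y, s) - D i z| < e'.
    move=> i; have [r r0 Hr] := within_halfspace_near (cDx (delta_mx 0 i)) zH e'0.
    by exists r.
  exists (\big[Num.min/1]_i r i).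
    by apply: lt_bigmin => // i _; have [] := Hr i.
  move=> i y s s0 ys ss; have [_] := Hr i; apply=> //.
    by apply: lt_le_trans ys _; exact: bigmin_le_cond.
  by apply: lt_le_trans ss _; exact: bigmin_le_cond.
exists (Num.min r1 r2); first by rewrite lt_min r10.
move=> y y' s s' s0 s'0; rewrite !lt_min => /andP[yr1 yr2] /andP[y'r1 y'r2].
move=> /andP[sr1 sr2] /andP[s'r1 s'r2].
(* Move in the state at time s' first, then in time at the state y. *)
have Hx : `|B (y', s') - B (y, s') - dotv (\row_i D i z) (y' - y)| <= e * `|y' - y|.
  set w := y' - y; have wE : y + w = y' by rewrite addrC subrK.
  have := @mean_value_linear R (fun a => B (y + a *: w, s'))
    (fun a => 'D_w (fun y' : 'rV[R]_n => B (y', s')) (y + a *: w))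
    0 1 (dotv (\row_i D i z) w) (e * `|w|) ler01.
  rewrite scale1r scale0r addr0 subr0 !mulr1 wE; apply.
  - move=> a a01.
    have der : derivable (fun y' : 'rV[R]_n => B (y', s')) (y + a *: w) w.
      by apply: diff_derivable; exact: (dx (y + a *: w, s')).
    rewrite (_ : (fun h => _) = (fun h => h^-1 *:
        (((fun y' : 'rV[R]_n => B (y', s')) \o shift (y + a *: w)) (h *: w) -
          B (y + a *: w, s')))).
      by apply: cvg_trans der; apply: cvg_app; exact: cvg_within.
    by apply/funext => h /=; rewrite scalerDl addrA [h *: w + _]addrC addrAC.
  - move=> a /andP[a0 a1].
    rewrite derive_dotv; last exact: (dx (y + a *: w, s')).
    rewrite -dotvBl (le_trans (dotv_norm _ _)) // ler_wpM2r //.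
    apply: (@le_trans _ _ (\sum_(i < n) e')).
      apply: ler_sum => i _; rewrite !mxE; apply/ltW/Hr2 => //=.
      rewrite (_ : _ - _ = (1 - a) *: (y - z.1) + a *: (y' - z.1)).
        rewrite (le_lt_trans (ler_normD _ _)) // !normrZ.
        rewrite [`|1 - a|]ger0_norm ?subr_ge0 // [`|a|]ger0_norm //.
        pose M := Num.max `|y - z.1| `|y' - z.1|.
        have Mr : M < r2 by rewrite gt_max yr2.
        apply: le_lt_trans Mr.
        have -> : M = (1 - a) * M + a * M by ring.
        by rewrite lerD // ler_wpM2l ?subr_ge0 // le_max lexx ?orbT.
      by apply/rowP => j; rewrite !mxE; ring.
    rewrite sumr_const card_ord -mulr_natl /e' mulrCA ger_pMr //.
    by rewrite ler_pdivrMr // mul1r lerDl.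
have Hmono u v : 0 <= u -> u <= v -> `|u - z.2| < r1 -> `|v - z.2| < r1 ->
    `|B (y, v) - B (y, u) - dB z * (v - u)| <= e * (v - u).
  move=> u0 uv ur vr.
  apply: (mean_value_linear (phi := fun t => B (y, t)) (dphi := fun t => dB (y, t))) => //.
    move=> t /andP[ut tv].
    apply: cvg_trans (dBE (y, t) (le_trans u0 ut)).
    by apply: cvg_app; apply: within_subset => h /= /andP[+ _]; exact: le_trans.
  move=> t /andP[ut tv]; apply/ltW/Hr1 => //; first exact: le_trans ut.
  by move: ur vr; rewrite !ltr_norml => /andP[h1 h2] /andP[h3 h4]; lra.
have Ht : `|B (y, s') - B (y, s) - dB z * (s' - s)| <= e * `|s' - s|.
  have [ss'|/ltW s's] := leP s s'.
    by rewrite [`|s' - s|]ger0_norm ?subr_ge0 //; exact: Hmono.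
  rewrite [`|s' - s|]distrC [`|s - s'|]ger0_norm ?subr_ge0 // -normrN.
  rewrite (_ : - (B (y, s') - B (y, s) - dB z * (s' - s)) =
    B (y, s) - B (y, s') - dB z * (s - s')); last ring.
  exact: Hmono.
have -> : B (y', s') - B (y, s) - (dotv (\row_i D i z) (y' - y) + dB z * (s' - s)) =
  (B (y', s') - B (y, s') - dotv (\row_i D i z) (y' - y)) +
  (B (y, s') - B (y, s) - dB z * (s' - s)) by ring.
by rewrite (le_trans (ler_normD _ _)) // [leRHS]mulrDr; apply: lerD.
Qed.

(** * The barrier function along solutions *)

Lemma limf_einf_ge (R : realType) (T : choiceType) (Y : filteredType T)
    (f : Y -> \bar R) (F : set_system Y) (a : \bar R) :
  F [set q | (a <= f q)%E] -> (a <= limf_einf f F)%E.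
Proof.
move=> Fa; rewrite limf_einfE; apply: le_ereal_sup_tmp.
exists (ereal_inf (f @` [set q | (a <= f q)%E])); first by exists [set q | (a <= f q)%E].
by apply: le_ereal_inf_tmp => _ [q aq <-].
Qed.

(** The directions (w, s) competing in the lower limit tend to (v, 1), so s > 0
    and the perturbed points stay in the half-space; strict differentiability
    then bounds every quotient from below by dotv c w + d * s up to a small
    error, which tends to dotv c v + d. *)
Lemma contingent_derivative_ge (R : realType) (n : nat) (B : 'rV[R]_n * R -> R)
    (z : 'rV[R]_n * R) (c v : 'rV[R]_n) (d : R) :
  halfspace R n z -> strictly_differentiable B z c d ->
  ((dotv c v + d)%:E <= contingent_derivative B z (v, 1%R))%E.
Proof.
move=> zH sB; apply/lee_addgt0Pr => e e0.
pose K := \sum_(i < n) `|c 0 i|.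
have K0 : 0 <= K by apply: sumr_ge0.
(* The errors are eta * (`|v| + 3) from the increment of B, and at most
   K * eta and `|d| * eta from replacing (w, s) by (v, 1). *)
pose eta := e / (`|v| + K + `|d| + 3%:R).
have den0 : 0 < `|v| + K + `|d| + 3%:R by rewrite ltr_wpDl // !addr_ge0.
have eta0 : 0 < eta by rewrite divr_gt0.
have etaE : e = eta * (`|v| + K + `|d| + 3%:R) by rewrite divfK // gt_eqF.
have [r r0 Hr] := sB _ eta0.
(* h < rho keeps z + h *: (w, s) within r of z, as `|w| and s are less than
   `|v| + 2. *)
pose rho := r / (`|v| + 2).
have rho0 : 0 < rho by rewrite divr_gt0 // ltr_wpDl.
pose mu := Num.min 1 eta / 2.
have mu0 : 0 < mu by rewrite divr_gt0 // lt_min ltr01.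
have mu1 : mu < 1.
  have : Num.min 1 eta <= 1 by rewrite ge_min lexx.
  rewrite /mu; lra.
have mueta : mu <= eta.
  have : Num.min 1 eta <= eta by rewrite ge_min lexx orbT.
  rewrite /mu; lra.
suff : ((dotv c v + d - e)%:E <= contingent_derivative B z (v, 1%R))%E.
  by move=> h; rewrite -leeBlDr // -EFinB.
apply: limf_einf_ge.
exists ([set h : R | 0 < h /\ h < rho],
        [set w : 'rV[R]_n * R | `|w.1 - v| < mu /\ `|w.2 - 1| < mu]).
  split => /=.
    near=> h; split; near: h; first exact: nbhs_right_gt.
    exact: nbhs_right_lt.
  apply/nbhs_ballP; exists mu => //= w; rewrite /ball /= => -[].
  by rewrite -!ball_normE /= => h1 h2; rewrite distrC h1 distrC.
move=> [h [w s]] /= [[h0 hrho] [wv s1]].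
rewrite lee_fin ler_pdivlMr //.
have [s_lo s_hi] : 1 - mu < s /\ s < 1 + mu by move: s1; rewrite ltr_distl => /andP[].
have wn : `|w| <= `|v| + mu.
  rewrite -(subrK v w) addrC (le_trans (ler_normD _ _)) // lerD2l; exact: ltW.
have hr : h * (`|v| + 2) < r by rewrite -ltr_pdivlMr // ltr_wpDl.
have hw0 : h * `|w| < r.
  by apply: le_lt_trans hr; rewrite ler_pM2l //; lra.
have hs0 : h * s < r.
  by apply: le_lt_trans hr; rewrite ler_pM2l //; have := normr_ge0 v; lra.
have hs_ge0 : 0 <= h * s by rewrite mulr_ge0 ?ltW //; lra.
have := Hr z.1 (z.1 + h *: w) z.2 (z.2 + h * s).
have -> : z + h *: (w, s) = (z.1 + h *: w, z.2 + h * s) by case: (z).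
rewrite ![_ + _ - z.1]addrAC ![_ + _ - z.2]addrAC !subrr !add0r !normr0 -surjective_pairing.
rewrite normrZ ger0_norm ?(ltW h0) // ger0_norm //.
rewrite dotvZ => /(_ zH (addr_ge0 zH hs_ge0) r0 hw0 r0 hs0).
rewrite ler_norml => /andP[lo _].
have cw : `|dotv c w - dotv c v| <= K * mu.
  have -> : dotv c w = dotv c (w - v) + dotv c v by rewrite -dotvD subrK.
  rewrite addrK (le_trans (dotv_norm _ _)) // ler_wpM2l // ltW //.
have ds : `|d * (s - 1)| <= `|d| * mu by rewrite normrM ler_wpM2l // ltW.
have cw' : dotv c w >= dotv c v - K * mu by move: cw; rewrite ler_norml => /andP[]; lra.
have ds' : d * s >= d - `|d| * mu by move: ds; rewrite ler_norml => /andP[]; lra.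
have ew : eta * (`|w| + s) <= eta * (`|v| + 3%:R) by rewrite ler_pM2l //; lra.
have Kmu : K * mu <= K * eta by rewrite ler_wpM2l.
have dmu : `|d| * mu <= `|d| * eta by rewrite ler_wpM2l.
have key : dotv c v + d - e <= dotv c w + d * s - eta * (`|w| + s).
  rewrite etaE; lra.
have : (dotv c v + d - e) * h <= (dotv c w + d * s - eta * (`|w| + s)) * h.
  by rewrite ler_pM2r.
lra.
Unshelve. all: by end_near. Qed.

(** Straddle lemma: the derivative at t approximates increments over any short
    interval containing t, not only those starting at t, since the two one-sided
    errors add. *)
Lemma derivable_straddle (R : realType) (n : nat) (x : R -> 'rV[R]_n) (t : R) (e : R) :
  derivable x t 1 -> 0 < e ->
  exists2 r : R, 0 < r & forall u v, u <= t -> t <= v -> v - u < r ->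
    `|x v - x u - (v - u) *: derive1 x t| <= e * (v - u).
Proof.
move=> dx e0.
have [r r0 Hr] : exists2 r : R, 0 < r & forall s, `|s - t| < r ->
    `|x s - x t - (s - t) *: derive1 x t| <= e * `|s - t|.
  rewrite derive1E.
  have : (fun h : R => h^-1 *: ((x \o shift t) (h *: 1) - x t)) @ 0^' --> 'D_1 x t by exact: dx.
  move=> /cvgrPdist_lt /(_ _ e0) /nbhs_ballP[r /= r0 Hr]; exists r => // s st.
  have [->|st0] := eqVneq s t; first by rewrite !subrr scale0r subr0 !normr0 mulr0.
  have st1 : s - t != 0 by rewrite subr_eq0.
  have := Hr (s - t); rewrite /ball /= sub0r normrN => /(_ st st1).
  rewrite /GRing.scale /= mulr1 subrK => h.
  rewrite -normrN opprB.
  have -> : (s - t) *: 'D_1 x t - (x s - x t) =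
     (s - t) *: ('D_1 x t - (s - t)^-1 *: (x s - x t)).
    by rewrite scalerBr scalerA mulfV // scale1r.
  by rewrite normrZ mulrC ler_wpM2r // ltW.
exists r => // u v ut tv uvr.
have -> : x v - x u - (v - u) *: derive1 x t =
  (x v - x t - (v - t) *: derive1 x t) - (x u - x t - (u - t) *: derive1 x t).
  by apply/rowP => j; rewrite !mxE; ring.
apply: (le_trans (ler_normB _ _)).
have h1 : `|v - t| = v - t by rewrite ger0_norm ?subr_ge0.
have h2 : `|u - t| = t - u by rewrite distrC ger0_norm ?subr_ge0.
have -> : e * (v - u) = e * (v - t) + e * (t - u) by ring.
apply: lerD.
  by have := Hr v; rewrite h1; apply; lra.
by have := Hr u; rewrite h2; apply; lra.
Qed.

Lemma strictly_differentiable_Lipschitz (R : realType) (n : nat)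
    (B : 'rV[R]_n * R -> R) (z : 'rV[R]_n * R) (c : 'rV[R]_n) (d : R) :
  strictly_differentiable B z c d ->
  exists (L r : R), [/\ 0 <= L, 0 < r & forall y y' s s',
    0 <= s -> 0 <= s' -> `|y - z.1| < r -> `|y' - z.1| < r ->
    `|s - z.2| < r -> `|s' - z.2| < r ->
    `|B (y', s') - B (y, s)| <= L * (`|y' - y| + `|s' - s|)].
Proof.
move=> /(_ _ ltr01)[r r0 Hr].
pose K := \sum_(i < n) `|c 0 i|.
have K0 : 0 <= K by apply: sumr_ge0.
exists (K + `|d| + 1), r; split => // [|y y' s s' s0 s'0 yr y'r sr s'r].
  by rewrite !addr_ge0.
have := Hr y y' s s' s0 s'0 yr y'r sr s'r; rewrite mul1r => h.
rewrite -[B (y', s') - B (y, s)](subrK (dotv c (y' - y) + d * (s' - s))).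
apply: (le_trans (ler_normD _ _)).
have h1 := ler_normD (dotv c (y' - y)) (d * (s' - s)).
have h2 := dotv_norm c (y' - y); rewrite -/K in h2.
have h3 : 0 <= K * `|s' - s| by rewrite mulr_ge0.
have h4 : 0 <= `|d| * `|y' - y| by rewrite mulr_ge0.
rewrite normrM in h1; lra.
Qed.

(** Chain rule for t |-> B (x t, t), as an upper bound on increments around t. *)
Lemma strictly_differentiable_straddle (R : realType) (n : nat)
    (B : 'rV[R]_n * R -> R) (x : R -> 'rV[R]_n) (t : R) (c : 'rV[R]_n) (d e : R) :
  strictly_differentiable B (x t, t) c d -> derivable x t 1 -> 0 < e ->
  exists2 r : R, 0 < r & forall u v, 0 <= u -> u <= t -> t <= v -> v - u < r ->
    B (x v, v) - B (x u, u) <= (dotv c (derive1 x t) + d + e) * (v - u).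
Proof.
move=> sB dx e0; set x' := derive1 x t.
pose K := \sum_(i < n) `|c 0 i|.
have K0 : 0 <= K by apply: sumr_ge0.
(* The error of B costs eta * (`|x'| + 2) and that of x costs K * eta. *)
pose eta := e / (K + `|x'| + 2).
have den0 : 0 < K + `|x'| + 2 by rewrite ltr_wpDl // addr_ge0.
have eta0 : 0 < eta by rewrite divr_gt0.
have etaE : e = eta * (K + `|x'| + 2) by rewrite divfK // gt_eqF.
have [r1 r10 Hr1] := sB _ eta0.
pose mu := Num.min 1 eta.
have mu0 : 0 < mu by rewrite lt_min ltr01.
have mu1 : mu <= 1 by rewrite ge_min lexx.
have mueta : mu <= eta by rewrite ge_min lexx orbT.
have [r2 r20 Hr2] := derivable_straddle dx mu0.
have inc u v : u <= t -> t <= v -> v - u < r2 ->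
    `|x v - x u| <= (`|x'| + 1) * (v - u).
  move=> ut tv uvr; have uv : 0 <= v - u by rewrite subr_ge0 (le_trans ut).
  have h := Hr2 u v ut tv uvr.
  rewrite -(subrK ((v - u) *: x') (x v - x u)) (le_trans (ler_normD _ _)) //.
  rewrite normrZ ger0_norm //.
  have : mu * (v - u) <= v - u by rewrite ler_piMl.
  move: h; rewrite -/x'; lra.
pose r3 := r1 / (`|x'| + 1).
have x1 : 0 < `|x'| + 1 by rewrite ltr_wpDl.
have r30 : 0 < r3 by rewrite divr_gt0.
exists (Num.min r1 (Num.min r2 r3)); first by rewrite !lt_min r10 r20.
move=> u v u0 ut tv; rewrite !lt_min => /and3P[uv1 uv2 uv3].
have uv : 0 <= v - u by rewrite subr_ge0 (le_trans ut).
have near1 s w : s <= w -> w - s <= v - u -> (`|x'| + 1) * (w - s) < r1.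
  move=> sw wsvu; apply: (@le_lt_trans _ _ ((`|x'| + 1) * (v - u))).
    by rewrite ler_pM2l.
  by rewrite mulrC -ltr_pdivlMr.
have xu : `|x u - x t| < r1.
  rewrite distrC; apply: (le_lt_trans (inc u t ut (lexx t) _)); first lra.
  by apply: near1 => //; lra.
have xv : `|x v - x t| < r1.
  apply: (le_lt_trans (inc t v (lexx t) tv _)); first lra.
  by apply: near1 => //; lra.
have tu : `|u - t| < r1 by rewrite distrC ger0_norm ?subr_ge0 //; lra.
have tv' : `|v - t| < r1 by rewrite ger0_norm ?subr_ge0 //; lra.
have v0 : 0 <= v by rewrite (le_trans u0) // (le_trans ut).
have := Hr1 (x u) (x v) u v u0 v0 xu xv tu tv'.
rewrite [`|v - u|]ger0_norm // => /(le_trans (ler_norm _)) main.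
set w := x v - x u in main *.
have wE : dotv c w = dotv c (w - (v - u) *: x') + (v - u) * dotv c x'.
  by rewrite -dotvZ -dotvD subrK.
have h1 := le_trans (ler_norm _) (dotv_norm c (w - (v - u) *: x')).
rewrite -/K in h1.
have h2 : K * `|w - (v - u) *: x'| <= K * (eta * (v - u)).
  by rewrite ler_wpM2l // (le_trans (Hr2 u v ut tv uv2)) // ler_wpM2r.
have h3 : eta * `|w| <= eta * ((`|x'| + 1) * (v - u)).
  by rewrite ler_pM2l //; exact: inc.
rewrite etaE; rewrite wE in main; lra.
Qed.

(** Lipschitz constants of B are only available near each point of the curve, so
    the almost everywhere argument is run on short intervals and the conclusion
    is glued by additivity. On those intervals good points satisfy
    dotv c x' + d <= contingent derivative <= 0. *)
Lemma barrier_nonincreasing (R : realType) (n : nat) (B : 'rV[R]_n * R -> R)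
    (x : R -> 'rV[R]_n) (a b : R) (N : set R) :
  continuously_differentiable_xt B -> 0 <= a -> a <= b ->
  absolutely_continuous_on a b x ->
  (@lebesgue_measure R).-negligible N ->
  (forall t, a <= t <= b -> ~ N t -> derivable x t 1 /\
     (contingent_derivative B (x t, t) (derive1 x t, 1%R) <= 0)%E) ->
  B (x b, b) <= B (x a, a).
Proof.
move=> B1 a0 ab ac N0 good.
have strict t : a <= t <= b -> exists (c : 'rV[R]_n) (d : R),
    strictly_differentiable B (x t, t) c d.
  move=> /andP[at_ _]; apply: C1_strictly_differentiable => //.
  exact: le_trans at_.
apply: (interval_induction (P := fun u v => B (x v, v) <= B (x u, u))) => //; last first.
  by move=> u c v _ _ _ _ uc cv; exact: le_trans uc.
move=> t /[dup] tab /strict[c [d /strictly_differentiable_Lipschitz]].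
move=> [L [r [L0 r0 HL]]].
have [r' r'0 Hr'] := absolutely_continuous_increment ac r0.
exists (Num.min r r'); first by rewrite lt_min r0.
move=> u v au ut tv vb; rewrite lt_min => /andP[uvr uvr'].
have close s : u <= s -> s <= v -> `|x s - x t| < r /\ `|s - t| < r.
  move=> us sv; have [st|/ltW ts] := leP s t.
    rewrite distrC [X in _ /\ X < _]distrC [`|t - s|]ger0_norm ?subr_ge0 //.
    by split; [apply: Hr' => // | ]; lra.
  rewrite [`|s - t|]ger0_norm ?subr_ge0 //.
  by split; [apply: Hr' => // | ]; lra.
apply: (@nonincreasing_of_ae_straddle R _ x (fun s => B (x s, s)) u v L N) => //.
- exact: le_trans tv.
- exact: absolutely_continuous_onW ac.
- move=> l s ul ls sv; rewrite -[s - l]ger0_norm ?subr_ge0 //.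
  have [? ?] := close l ul (le_trans ls sv).
  have [? ?] := close s (le_trans ul ls) sv.
  have l0 : 0 <= l by rewrite (le_trans a0) // (le_trans au).
  by apply: HL => //; exact: le_trans ls.
- move=> s /andP[us sv] Ns e e0.
  have sab : a <= s <= b by rewrite (le_trans au) // (le_trans sv).
  have [dx Bdec] := good s sab Ns.
  have [c' [d' sB]] := strict s sab.
  have cd0 : dotv c' (derive1 x s) + d' <= 0.
    rewrite -lee_fin; apply: le_trans Bdec; apply: contingent_derivative_ge => //.
    by rewrite /halfspace /= (le_trans a0) // (le_trans au).
  have [rr rr0 Hrr] := strictly_differentiable_straddle sB dx e0.
  exists rr => // p q up ps sq qv pq.
  apply: (le_trans (Hrr p q _ ps sq pq)).
    by rewrite (le_trans a0) // (le_trans au).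
  by rewrite ler_wpM2r ?subr_ge0 ?(le_trans ps) // gerDr.
Qed.

Theorem theorem2 (R : realType) (n p m : nat)
  (X : set 'rV[R]_n) (TT : set R) (U : set 'rV[R]_p)
  (f : 'I_m -> R -> 'rV[R]_n -> 'rV[R]_p -> 'rV[R]_n)
  (t0 T : R) (x0 : 'rV[R]_n) (Xu : set 'rV[R]_n)
  (B W : 'rV[R]_n * R -> R)
  (TT_ge0 : TT `<=` [set t | 0 <= t])
  (t0T_TT : `[t0, T]%classic `<=` TT)
  (U0 : U 0)
  (f_smooth : forall i, piecewise_smooth_on (TT `*` X `*` U)
     (fun z : R * 'rV[R]_n * 'rV[R]_p => f i z.1.1 z.1.2 z.2))
  (F_closed : forall t x u, TT t -> X x -> U u -> closed (inclusion_map f t x u))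
  (F_convex : forall t x u, TT t -> X x -> U u ->
     convex_set (inclusion_map f t x u))
  (F_uhc : forall t u, TT t -> U u ->
     upper_hemicontinuous_on X (fun x => inclusion_map f t x u))
  (F_osl : one_sided_Lipschitz TT X U (inclusion_map f))
  (t0_lt_T : t0 < T)
  (B_C1 : continuously_differentiable_xt B)
  (W_ge0 : forall z, halfspace R n z -> 0 <= W z)
  (W_posdef : positive_definite W)
  (W_measurable : lebesgue_measurable_fun W)
  (B_unsafe : forall xT, Xu xT -> 0 < B (xT, T) - B (x0, t0))
  (B_decrease : forall t x v, t0 <= t <= T -> X x -> inclusion_map f t x 0 v ->
     (contingent_derivative B (x, t) (v, 1%R) <= (- W (x, t))%:E)%E) :
  forall x : R -> 'rV[R]_n,
    is_solution X (fun t y => inclusion_map f t y 0) t0 T x0 x -> ~ Xu (x T).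
Proof.
move=> x [ac Xx xt0 sol] Xu_xT.
have t00 : 0 <= t0 by apply/TT_ge0/t0T_TT; rewrite /= in_itv /= lexx ltW.
have := B_unsafe _ Xu_xT; rewrite subr_gt0 ltNge -xt0 => /negP; apply.
apply: (barrier_nonincreasing B_C1 t00 (ltW t0_lt_T) ac sol) => t tT /contrapT /(_ tT).
move=> [dx Fx]; split => //; apply: (le_trans (B_decrease _ _ _ tT (Xx _ tT) Fx)).
rewrite lee_fin oppr_le0; apply: W_ge0.
by move: tT => /andP[+ _]; exact: le_trans.
Qed.
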